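(* Let $f:\mathbb{R}^n\to\mathbb{R}$ be a self-concordant-like function with constant $M_f>0$, let $g$ be a proper, lower semicontinuous convex function on $\mathbb{R}^n$, and let $F:=f+g$. Let $\{\mathbf{x}^k\}_{k\ge0}$ be a sequence generated from $\mathbf{x}^0\in\mathrm{dom}(F)$ by $\mathbf{x}^{k+1}:=\mathbf{x}^k+\alpha_k\mathbf{d}^k$, where $\mathbf{d}^k:=\mathbf{s}^k-\mathbf{x}^k$, $$\mathbf{s}^k:=\arg\min_{\mathbf{x}}\Big\{f(\mathbf{x}^k)+\langle\nabla f(\mathbf{x}^k),\mathbf{x}-\mathbf{x}^k\rangle+\tfrac12\langle\mathbf{D}_k(\mathbf{x}-\mathbf{x}^k),\mathbf{x}-\mathbf{x}^k\rangle+g(\mathbf{x})\Big\},$$ and $\mathbf{D}_k$ is a diagonal matrix with positive diagonal entries. Put $\lambda_k:=\langle\nabla^2f(\mathbf{x}^k)\mathbf{d}^k,\mathbf{d}^k\rangle^{1/2}$, $r_k:=M_f\|\mathbf{d}^k\|_2$, $\beta_k:=\langle\mathbf{D}_k\mathbf{d}^k,\mathbf{d}^k\rangle^{1/2}$, and consider the step-size $$\alpha_k:=\frac{1}{r_k}\ln\left(1+\frac{\beta_k^2r_k}{\lambda_k^2}\right).$$ If $\beta_k^2r_k\le(e^{r_k}-1)\lambda_k^2$, then $\alpha_k\in(0,1]$ and $$F(\mathbf{x}^{k+1})\le F(\mathbf{x}^k)-\frac{\beta_k^2}{r_k}\left[\left(1+\frac{\lambda_k^2}{r_k\beta_k^2}\right)\ln\left(1+\frac{\beta_k^2r_k}{\lambda_k^2}\right)-1\right].$$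 Moreover, this step-size $\alpha_k$ is optimal (with respect to the worst-case performance).
   Context: Self-concordant-like: a convex function $f\in\mathcal{C}^3(\mathbb{R}^n)$ is self-concordant-like with constant $M_f>0$ if for all $\mathbf{x}\in\mathrm{dom}(f)$ and $\mathbf{u}\in\mathbb{R}^n$ the function $\varphi(t):=f(\mathbf{x}+t\mathbf{u})$ satisfies $|\varphi'''(t)|\le M_f\,\varphi''(t)\,\|\mathbf{u}\|_2$ for $t\in\mathbb{R}$. The formulas are understood at iterations with $\mathbf{d}^k\ne0$ and $\lambda_k>0$, so that all quotients are defined. *)

(* Defs.v *)
From HB Require Import structures.
From mathcomp Require Import all_boot all_order all_algebra.
From mathcomp Require Import all_classical all_reals all_analysis.

Set Implicit Arguments.
Unset Strict Implicit.
Unset Printing Implicit Defensive.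

Import Order.TTheory GRing.Theory Num.Theory.
Import numFieldNormedType.Exports.

Local Open Scope classical_set_scope.
Local Open Scope ring_scope.

Section Euclidean.
Context {R : realType} {n : nat}.
Implicit Types (u v : 'cV[R]_n) (A : 'M[R]_n).

Definition dotv u v : R := (u^T *m v) 0 0.

(* The norm [`|u|] that the library puts on matrices is the max norm; it
   induces the same topology but is not the norm used here. *)
Definition norm2 u : R := Num.sqrt (dotv u u).

Definition wnorm A u : R := Num.sqrt (dotv (A *m u) u).

Definition basisv (i : 'I_n) : 'cV[R]_n := delta_mx i 0.

End Euclidean.

Section Smooth.
Context {R : realType} {n : nat}.
Implicit Types (f : 'cV[R]_n -> R) (x : 'cV[R]_n).

Definition gradient f x : 'cV[R]_n := \col_i 'D_(basisv i) f x.

Definition hessian f x : 'M[R]_n :=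
  \matrix_(i, j) 'D_(basisv i) ('D_(basisv j) f) x.

Fixpoint class_C (m : nat) f : Prop :=
  if m is m'.+1 then
    continuous f /\
    forall i, (forall x, derivable f x (basisv i)) /\
              class_C m' ('D_(basisv i) f)
  else continuous f.

Definition self_concordant_like (M : R) f : Prop :=
  [/\ 0 < M,
      class_C 3 f,
      convex_function [set: 'cV[R]_n] f &
      forall (x u : 'cV[R]_n) (t : R),
        let phi := fun s : R => f (x + s *: u) in
        `| phi^`(3)%classic t | <= M * phi^`(2)%classic t * norm2 u].

End Smooth.

Section Composite.
Context {R : realType} {n : nat}.
Implicit Types (f : 'cV[R]_n -> R) (g : 'cV[R]_n -> \bar R).
Implicit Types (x d y : 'cV[R]_n) (D : 'M[R]_n).
Local Open Scope ereal_scope.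

Definition eproper g : Prop :=
  (forall x, g x != -oo) /\ (exists x, g x < +oo).

(* Meant for [g] that never takes the value [-oo]; recall [0 * +oo = 0]. *)
Definition econvex g : Prop :=
  forall x y (t : R), (0 <= t <= 1)%R ->
    g (t *: x + (1 - t) *: y)%R <= t%:E * g x + (1 - t)%:E * g y.

Definition objective f g x : \bar R := (f x)%:E + g x.

Definition is_argmin (Q : 'cV[R]_n -> \bar R) x : Prop :=
  forall y, Q x <= Q y.

Definition prox_model f g D x y : \bar R :=
  (f x + dotv (gradient f x) (y - x)
     + 2^-1 * dotv (D *m (y - x)) (y - x))%:E + g y.

(* The worst-case performance of a step-size [a]: the supremum of
   [F (x + a d) - F x] over all problems [F = f + g] that yield, at the current
   point [x] and with the matrix [D], the same search direction [d] and the
   same local norm [lam] (hence the same r, beta and lambda). *)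
Definition worst_case (M : R) x D d (lam a : R) : \bar R :=
  ereal_sup [set z | exists f g,
    [/\ self_concordant_like M f,
        [/\ eproper g, lower_semicontinuous g & econvex g],
        objective f g x < +oo,
        is_argmin (prox_model f g D x) (x + d)%R /\
        wnorm (hessian f x) d = lam &
        z = objective f g (x + a *: d)%R - objective f g x]].

End Composite.

(* Main.v *)
(** On the line [t |-> f (x + t d)], self-concordance-likeness is a differential
inequality [phi''' <= r phi''], so Gronwall and two integrations give
[f (x + a d) <= f x + a <grad f x, d> + lambda^2 / r^2 (e^(r a) - 1 - r a)].
Optimality of the prox step gives [g s - g x <= - <grad f x, d> - beta^2], and
convexity of [g] then yields, for [a] in [[0, 1]], the bound
[U a := - a beta^2 + lambda^2 / r^2 (e^(r a) - 1 - r a)] on [F (x + a d) - F x].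
The function [U] is convex and its minimiser over the whole line is [alpha].
Conversely [U a] is attained, for every real [a], by an exponential [f] together
with a linear [g]; hence the worst case of [alpha] is [U alpha], and that of any
[a] is at least [U a]. *)
Require Import Defs.
From HB Require Import structures.
From mathcomp Require Import all_boot all_order all_algebra.
From mathcomp Require Import all_classical all_reals all_analysis.
From mathcomp Require Import ring lra.
Import Order.TTheory GRing.Theory Num.Theory.
Import numFieldNormedType.Exports.
Local Open Scope classical_set_scope.
Local Open Scope ring_scope.

(** * Directional derivatives through one-variable calculus *)

Lemma is_derive_mull {R : realType} (a t : R) :
  is_derive t 1 (fun s : R => a * s) a.
Proof.
have H := is_deriveM (is_derive_cst a t (1 : R)) (is_derive_id t (1 : R)).
by apply: (is_derive_eq H); rewrite [X in X + _]mulr1 scaler0 addr0.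
Qed.

(** Both sides have literally the same difference quotient. This lets one-variable results on
    [s |-> f (x + s *: v)] be read as statements on directional derivatives. *)
Lemma is_derive_line {R : realType} {V : normedModType R} (f : V -> R)
    (x v : V) (t l : R) :
  is_derive (x + t *: v) v f l <->
  is_derive t 1 (fun s : R => f (x + s *: v)) l.
Proof.
have E : (fun h : R => h^-1 *: ((f \o shift (x + t *: v)) (h *: v)
                         - f (x + t *: v))) =
         (fun h : R => h^-1 *: (((fun s : R => f (x + s *: v)) \o shift t)
             (h *: (1 : R)) - f (x + t *: v))).
  apply/funext => h /=; congr (_ *: (f _ - _)).
  by rewrite [h *: 1]mulr1 scalerDl [RHS]addrCA.
by split=> -[H1 H2]; split; move: H1 H2; rewrite /derivable /derive E.
Qed.

Lemma is_derive_dirZ {R : realType} {V : normedModType R} (f : V -> R)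
    (x v : V) (a l : R) :
  is_derive x v f l -> is_derive x (a *: v) f (a * l).
Proof.
move=> H.
have {}H : is_derive (a * 0) 1 (fun s : R => f (x + s *: v)) l.
  by apply: (is_derive_line f x v (a * 0) l).1; rewrite mulr0 scale0r addr0.
have K : is_derive (0 : R) 1 (fun s : R => a * s) a. exact: is_derive_mull.
have := is_derive1_comp H K.
have -> : x = x + (0 : R) *: (a *: v) by rewrite scale0r addr0.
rewrite mulrC => L; apply: (is_derive_line f x (a *: v) 0 (a * l)).2.
move: L; rewrite scale0r addr0 /comp.
by under eq_fun do rewrite mulrC -scalerA.
Qed.

(** The mean value theorem based at 0 for [h] of either sign. The bound [|c| <= |h|] makes the
    intermediate point tend to 0 with [h]. *)
Lemma MVT0 {R : realType} (p q : R -> R) (h : R) :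
  (forall t : R, is_derive t 1 p (q t)) ->
  exists2 c, `|c| <= `|h| & p h - p 0 = q c * h.
Proof.
move=> dp.
have cp a b : {within `[a, b], continuous p}.
  apply: derivable_within_continuous => t _.
  by have [] := dp t.
have [h0|/ltW h0] := leP 0 h.
  have [//|c] := MVT_segment h0 (fun t _ => dp t).
  rewrite in_itv/= => /andP[c0 ch] ->; exists c; last by rewrite subr0.
  by rewrite !ger0_norm.
have [//|c] := MVT_segment h0 (fun t _ => dp t).
rewrite in_itv/= => /andP[c0 ch] E; exists c; first by rewrite !ler0_norm ?lerN2.
by rewrite -[LHS]opprB E sub0r mulrN opprK.
Qed.

(** The increment from [x] to [x + h (v + w)] is split into a leg along [w], handled by the
    derivative at [x], and a leg along [v], handled by the mean value theorem. The intermediate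
    point of the second leg tends to [x], where ['D_v f] is continuous. *)
Lemma is_derive_dirD {R : realType} {V : normedModType R} (f : V -> R)
    (x v w : V) (l : R) :
  (forall y, derivable f y v) -> {for x, continuous ('D_v f)} ->
  is_derive x w f l -> is_derive x (v + w) f ('D_v f x + l).
Proof.
move=> dv cv [dw dwl].
have /choice[c Hc] : forall h : R, exists c : R, `|c| <= `|h| /\
    f (x + h *: w + h *: v) - f (x + h *: w) =
      'D_v f (x + h *: w + c *: v) * h.
  move=> h.
  have dp (t : R) : is_derive t 1 (fun s : R => f (x + h *: w + s *: v))
                  ('D_v f (x + h *: w + t *: v)).
    exact: (is_derive_line f (x + h *: w) v t _).1 (derivableP (dv _)).
  have [c ch] := MVT0 _ _ h dp.
  by rewrite scale0r addr0 => ?; exists c.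
have c0 : c h @[h --> 0^'] --> (0 : R).
  apply/cvgr0Pnorm_lt => e e0; near=> h.
  have [/le_lt_trans-> //] := Hc h.
  near: h; apply: dnbhs0_lt => //.
have h0 : h @[h --> (0 : R)^'] --> (0 : R).
  apply/cvgr0Pnorm_lt => e e0; near=> h.
  near: h; apply: dnbhs0_lt => //.
have xc : x + h *: w + c h *: v @[h --> 0^'] --> x.
  have : x + h *: w + c h *: v @[h --> 0^'] --> x + (0 : R) *: w + (0 : R) *: v.
    apply: cvgD; last exact: cvgZr_tmp.
    by apply: cvgD; [exact: cvg_cst | exact: cvgZr_tmp].
  by rewrite !scale0r !addr0.
have L : h^-1 *: ((f \o shift x) (h *: (v + w)) - f x) @[h --> 0^']
    --> 'D_v f x + l.
  have D1 : 'D_v f (x + h *: w + c h *: v) @[h --> 0^'] --> 'D_v f x.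
    exact: (cvg_comp _ _ xc cv).
  have D2 : h^-1 *: ((f \o shift x) (h *: w) - f x) @[h --> 0^'] --> l.
    by rewrite -dwl; exact: dw.
  apply: cvg_trans (cvgD D1 D2); apply: near_eq_cvg; near=> h.
  have hn0 : h != 0 by near: h; exact: nbhs_dnbhs_neq.
  have [_ E] := Hc h.
  rewrite /= [h *: (v + w)]scalerDr.
  have -> : h *: v + h *: w + x = x + h *: w + h *: v.
    by rewrite addrC [h *: v + _]addrC addrA.
  rewrite fctE [h *: w + x]addrC -[X in _ = _ *: X](subrKA (f (x + h *: w))) E [RHS]scalerDr.
  by rewrite [_ *: (_ * _)]mulrC mulfK.
split; first by apply/cvg_ex; exists ('D_v f x + l).
exact: cvg_lim L.
Unshelve. all: by end_near.
Qed.

Lemma is_derive_lincomb {R : realType} (n : nat) (c : 'I_n -> R)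
    (h : 'I_n -> R -> R) (dh : 'I_n -> R) (t : R) :
  (forall i, is_derive t 1 (h i) (dh i)) ->
  is_derive t 1 (fun s => \sum_i c i * h i s) (\sum_i c i * dh i).
Proof.
move=> dF.
have H i : is_derive t 1 (fun s : R => c i * h i s) (c i * dh i).
  apply: (is_derive_eq (is_deriveM (is_derive_cst (c i) t (1 : R)) (dF i))).
  by rewrite scaler0 addr0.
have := is_derive_sum H.
by congr is_derive; apply/funext => s; rewrite fct_sumE.
Qed.

(** * Directional derivatives of smooth functions in terms of partial derivatives *)

Section ClassC.
Context {R : realType} {n : nat}.
Implicit Types (f : 'cV[R]_n -> R) (x u : 'cV[R]_n).

Lemma class_CW m f : class_C m.+1 f -> class_C m f.
Proof.
elim: m f => [f []//|m IH f [cf H]]; split=> // i.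
by have [dfi Ci] := H i; split=> //; exact: IH.
Qed.

Lemma class_C_partial m f i : class_C m.+1 f -> class_C m ('D_(basisv i) f).
Proof. by case=> _ /(_ i)[]. Qed.

(** Written as a sum of partial derivatives so that it can be differentiated again term by term. *)
Definition directional f u x : R := \sum_i u i 0 * 'D_(basisv i) f x.

(** Expand [u] in the standard basis and add one coordinate direction at a time; at each addition
    the newly added partial derivative is the continuous one. *)
Lemma is_derive_directional f x u : class_C 1 f ->
  is_derive x u f (directional f u x).
Proof.
move=> [cf Cf].
have {1}-> : u = \sum_i u i 0 *: basisv i.
  rewrite [LHS]matrix_sum_delta; apply: eq_bigr => i _.
  by rewrite big_ord1.
rewrite /directional; elim: (index_enum _) => [|i r IH].
  by rewrite !big_nil; exact: is_derive0.
have D y : is_derive y (u i 0 *: basisv i) f (u i 0 * 'D_(basisv i) f y).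
  by apply: is_derive_dirZ; apply: derivableP; have [] := Cf i.
have E : 'D_(u i 0 *: basisv i) f = fun y => u i 0 * 'D_(basisv i) f y.
  by apply/funext => y; exact: (@derive_val _ _ _ _ _ _ _ (D y)).
have cE : {for x, continuous ('D_(u i 0 *: basisv i) f)}.
  rewrite E; have [_ c] := Cf i; exact: (cvgM (cvg_cst _) (c x)) .
have K := is_derive_dirD f x _ _ _ (fun y => @ex_derive _ _ _ _ _ _ _ (D y)) cE IH.
rewrite !big_cons; apply: (is_derive_eq K); congr (_ + _).
exact: (@derive_val _ _ _ _ _ _ _ (D x)).
Qed.

Lemma is_derive_line_C1 f x u (t : R) : class_C 1 f ->
  is_derive t 1 (fun s : R => f (x + s *: u)) (directional f u (x + t *: u)).
Proof.
move=> Cf; exact: (is_derive_line f x u t _).1 (is_derive_directional _ _ _ Cf).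
Qed.

Definition directional2 f u x : R :=
  \sum_i u i 0 * directional ('D_(basisv i) f) u x.

Lemma is_derive_line_C2 f x u (t : R) : class_C 2 f ->
  is_derive t 1 (fun s : R => directional f u (x + s *: u))
    (directional2 f u (x + t *: u)).
Proof.
move=> Cf.
apply: (is_derive_lincomb n (fun i => u i 0)
  (fun i s => 'D_(basisv i) f (x + s *: u))
  (fun i => directional ('D_(basisv i) f) u (x + t *: u))) => i.
exact/is_derive_line_C1/class_C_partial.
Qed.

Lemma derivable_line_C3 f x u (t : R) : class_C 3 f ->
  derivable (fun s : R => directional2 f u (x + s *: u)) t 1.
Proof.
move=> Cf.
have := is_derive_lincomb n (fun i => u i 0)
  (fun i s => directional ('D_(basisv i) f) u (x + s *: u))
  (fun i => directional2 ('D_(basisv i) f) u (x + t *: u)) t.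
case=> // i.
exact/is_derive_line_C2/class_C_partial.
Qed.

Lemma directionalE f u x : directional f u x = dotv (gradient f x) u.
Proof.
by rewrite /dotv mxE; apply: eq_bigr => i _; rewrite !mxE mulrC.
Qed.

Lemma directional2E f u x :
  directional2 f u x = dotv (hessian f x *m u) u.
Proof.
rewrite /dotv mxE /directional2 /directional.
under eq_bigr do rewrite mulr_sumr.
(* Exchanging the sums matches the order of differentiation used in [hessian]. *)
rewrite exchange_big; apply: eq_bigr => i _.
rewrite !mxE mulr_suml; apply: eq_bigr => j _; rewrite !mxE.
by rewrite mulrC -mulrA [_ * u i 0]mulrC mulrCA mulrA mulrC.
Qed.

End ClassC.

(** * Exponential growth bound along a line *)

Lemma derive_le0_le {R : realType} (p q : R -> R) (t : R) :
  (forall s : R, is_derive s 1 p (q s)) -> (forall s, 0 <= s -> q s <= 0) ->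
  0 <= t -> p t <= p 0.
Proof.
move=> dp q0 t0.
have cp : {within `[0, t], continuous p}.
  by apply: derivable_within_continuous => s _; have [] := dp s.
have [c] := MVT_segment t0 (fun s _ => dp s) cp.
rewrite in_itv/= => /andP[c0 _] E.
by rewrite -subr_le0 E subr0 mulr_le0_ge0 ?q0.
Qed.

Lemma is_derive_expRM {R : realType} (a t : R) :
  is_derive t 1 (fun s => expR (a * s)) (a * expR (a * t)).
Proof.
rewrite mulrC.
exact: (is_derive1_comp (is_derive_expR (a * t)) (is_derive_mull a t)).
Qed.

(* Gronwall: [p2 t * exp (- r t)] is nonincreasing, so [p2 t <= p2 0 * exp (r t)];
   integrate twice. *)
Lemma exp_growth_bound {R : realType} (p p1 p2 p3 : R -> R) (r a : R) :
  (forall t : R, is_derive t 1 p (p1 t)) ->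
  (forall t : R, is_derive t 1 p1 (p2 t)) ->
  (forall t : R, is_derive t 1 p2 (p3 t)) ->
  (forall t, p3 t <= r * p2 t) -> 0 < r -> 0 <= a ->
  p a <= p 0 + a * p1 0 + p2 0 / r ^+ 2 * (expR (r * a) - 1 - r * a).
Proof.
move=> d1 d2 d3 H r0 a0.
have B2 t : 0 <= t -> p2 t <= p2 0 * expR (r * t).
  move=> t0.
  have D (s : R) := is_deriveM (d3 s) (is_derive_expRM (- r) s).
  have := derive_le0_le _ _ _ D _ t0; rewrite !fctE /= mulr0 expR0 mulr1 => K.
  have : p2 t * expR (- r * t) <= p2 0.
    apply: K => s s0.
    have -> : p2 s *: (- r * expR (- r * s)) + expR (- r * s) *: p3 s =
       (p3 s - r * p2 s) * expR (- r * s).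
      by rewrite /GRing.scale /=; ring.
    by rewrite mulr_le0_ge0 ?expR_ge0 // subr_le0.
  by rewrite mulNr expRN ler_pdivrMr ?expR_gt0.
have B1 t : 0 <= t -> p1 t <= p1 0 + p2 0 / r * (expR (r * t) - 1).
  move=> t0.
  have E (s : R) := is_deriveM (is_derive_cst (p2 0 / r) s (1 : R)) (is_derive_expRM r s).
  have D (s : R) := is_deriveB (d2 s) (E s).
  have := derive_le0_le _ _ _ D _ t0.
  rewrite !fctE /= mulr0 expR0 mulr1 => K.
  suff: p1 t - p2 0 / r * expR (r * t) <= p1 0 - p2 0 / r by lra.
  apply: K => s s0; rewrite scaler0 addr0 /GRing.scale /= mulrA divfK ?gt_eqF //.
  by rewrite subr_le0 B2.
(* Second integration: subtracting from [p] an antiderivative of the bound [B1] leaves a function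
   with nonpositive derivative on the half-line. *)
have E1 (s : R) := is_deriveM (is_derive_cst (p2 0 / r ^+ 2) s (1 : R)) (is_derive_expRM r s).
have E2 (s : R) := is_derive_mull (p1 0 - p2 0 / r) s.
have D (s : R) := is_deriveB (is_deriveB (d1 s) (E1 s)) (E2 s).
have := derive_le0_le _ _ _ D _ a0.
rewrite !fctE /= !mulr0 expR0 mulr1 => K.
suff L : p a - p2 0 / r ^+ 2 * expR (r * a) - (p1 0 - p2 0 / r) * a
        <= p 0 - p2 0 / r ^+ 2 - 0.
  rewrite (_ : p2 0 / r ^+ 2 * (expR (r * a) - 1 - r * a) =
    p2 0 / r ^+ 2 * expR (r * a) - p2 0 / r ^+ 2 - p2 0 / r * a); first by lra.
  by field; rewrite gt_eqF.
apply: K => s s0; rewrite scaler0 addr0 /GRing.scale /=.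
have := B1 s s0.
rewrite (_ : p2 0 / r ^+ 2 * (r * expR (r * s)) = p2 0 / r * expR (r * s)); first by lra.
by field; rewrite gt_eqF.
Qed.

(** The growth bound applied to [phi s = f (x + s d)], using the upper half of the inequality on the
    absolute value. The work lies in identifying the iterated derivatives of [phi] with
    [directional] and [directional2]. *)
Lemma self_concordant_like_upper_bound {R : realType} {n : nat} (M : R)
    (f : 'cV[R]_n -> R) (x d : 'cV[R]_n) (r a : R) :
  self_concordant_like M f -> r = M * norm2 d -> 0 < r -> 0 <= a ->
  f (x + a *: d) <= f x + a * dotv (gradient f x) d +
    dotv (hessian f x *m d) d / r ^+ 2 * (expR (r * a) - 1 - r * a).
Proof.
move=> [M0 Cf _ scl] rE r0 a0.
have D1 (t : R) := is_derive_line_C1 f x d t (class_CW _ _ (class_CW _ _ Cf)).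
have D2 (t : R) := is_derive_line_C2 f x d t (class_CW _ _ Cf).
have D3 (t : R) := derivableP (derivable_line_C3 f x d t Cf).
have E1 : (fun s : R => f (x + s *: d))^`()%classic =
    fun t => directional f d (x + t *: d).
  by apply/funext => t; rewrite derive1E; exact: (@derive_val _ _ _ _ _ _ _ (D1 t)).
have E2 : (fun s : R => f (x + s *: d))^`(2)%classic =
    fun t => directional2 f d (x + t *: d).
  apply/funext => t; rewrite /derive1n /= E1.
  by rewrite derive1E; exact: (@derive_val _ _ _ _ _ _ _ (D2 t)).
have H t : 'D_1 (fun s : R => directional2 f d (x + s *: d)) t <=
    r * directional2 f d (x + t *: d).
  have E3 : (fun s : R => f (x + s *: d))^`(3)%classic =
      (fun s : R => directional2 f d (x + s *: d))^`()%classic by rewrite -E2.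
  have : `|(fun s : R => f (x + s *: d))^`(3)%classic t| <=
      M * (fun s : R => f (x + s *: d))^`(2)%classic t * norm2 d := scl x d t.
  rewrite E2 E3 derive1E.
  by rewrite rE mulrAC; apply: le_trans; rewrite ler_norm.
have := exp_growth_bound _ _ _ _ r a D1 D2 D3 H r0 a0.
by rewrite scale0r addr0 directionalE directional2E.
Qed.

(** * Euclidean inner product and diagonal quadratic forms *)

Section DotProduct.
Context {R : realType} {n : nat}.
Implicit Types (u v w x y : 'cV[R]_n) (D : 'M[R]_n).

Lemma dotvE u v : dotv u v = \sum_i u i 0 * v i 0.
Proof. by rewrite /dotv mxE; apply: eq_bigr => i _; rewrite mxE. Qed.

Lemma dotvC u v : dotv u v = dotv v u.
Proof. by rewrite !dotvE; apply: eq_bigr => i _; rewrite mulrC. Qed.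

Lemma dotvDr u v w : dotv u (v + w) = dotv u v + dotv u w.
Proof. by rewrite /dotv mulmxDr mxE. Qed.

Lemma dotvNr u v : dotv u (- v) = - dotv u v.
Proof. by rewrite /dotv mulmxN mxE. Qed.

Lemma dotvZr a u v : dotv u (a *: v) = a * dotv u v.
Proof. by rewrite /dotv -scalemxAr mxE. Qed.

Lemma dotvDl u v w : dotv (u + v) w = dotv u w + dotv v w.
Proof. by rewrite !(dotvC _ w) dotvDr. Qed.

Lemma dotvNl u v : dotv (- u) v = - dotv u v.
Proof. by rewrite !(dotvC _ v) dotvNr. Qed.

Lemma dotvZl a u v : dotv (a *: u) v = a * dotv u v.
Proof. by rewrite !(dotvC _ v) dotvZr. Qed.

Lemma dotv_ge0 u : 0 <= dotv u u.
Proof. by rewrite dotvE sumr_ge0 // => i _; rewrite -expr2 sqr_ge0. Qed.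

Lemma dotv_diag D u v : is_diag_mx D ->
  dotv (D *m u) v = \sum_i D i i * u i 0 * v i 0.
Proof.
move=> dD; rewrite dotvE; apply: eq_bigr => i _; rewrite mxE (bigD1 i) //=.
rewrite big1 ?addr0 // => j ji; rewrite (is_diag_mxP dD) ?mul0r //.
by rewrite eq_sym.
Qed.

Lemma dotv_diagC D u v : is_diag_mx D -> dotv (D *m u) v = dotv (D *m v) u.
Proof. by move=> dD; rewrite !dotv_diag //; apply: eq_bigr => i _; ring. Qed.

Lemma dotv_diag_gt0 D u : is_diag_mx D -> (forall i, 0 < D i i) -> u != 0 ->
  0 < dotv (D *m u) u.
Proof.
move=> dD D0 u0.
have T i : 0 <= D i i * u i 0 * u i 0.
  by rewrite -mulrA -expr2 mulr_ge0 ?sqr_ge0 // ltW.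
rewrite dotv_diag // lt_def sumr_ge0 // andbT.
apply: contra u0 => /eqP E; apply/eqP/colP => i; rewrite mxE.
have /(_ i isT)/eqP := psumr_eq0P (fun i _ => T i) E.
by rewrite -mulrA -expr2 mulf_eq0 sqrf_eq0 gt_eqF ?D0 //= => /eqP.
Qed.

Lemma dotv_diag_ge0 D u : is_diag_mx D -> (forall i, 0 < D i i) ->
  0 <= dotv (D *m u) u.
Proof.
move=> dD D0; have [->|u0] := eqVneq u 0; last exact/ltW/dotv_diag_gt0.
by rewrite mulmx0 /dotv mulmx0 mxE.
Qed.

Lemma dotv_gt0 u : u != 0 -> 0 < dotv u u.
Proof.
move=> u0; rewrite -[X in dotv X _]mul1mx; apply: dotv_diag_gt0 => [|i|//].
  by apply/is_diag_mxP => i j ij; rewrite mxE -val_eqE (negbTE ij).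
by rewrite mxE eqxx ltr01.
Qed.

Lemma sqr_norm2 u : norm2 u ^+ 2 = dotv u u.
Proof. by rewrite sqr_sqrtr // dotv_ge0. Qed.

Lemma norm2_gt0 u : u != 0 -> 0 < norm2 u.
Proof. by move=> u0; rewrite sqrtr_gt0 dotv_gt0. Qed.

(** Cauchy-Schwarz, from the nonnegative square of [<u,u> v - <u,v> u]. *)
Lemma dotv_le_norm2 u v : `|dotv u v| <= norm2 u * norm2 v.
Proof.
have [->|u0] := eqVneq u 0.
  by rewrite dotvE big1 ?normr0 ?mulr_ge0 ?sqrtr_ge0 // => i _; rewrite mxE mul0r.
have p0 := dotv_gt0 u u0.
have := dotv_ge0 (dotv u u *: v - dotv u v *: u).
rewrite !(dotvDl, dotvDr, dotvNl, dotvNr, dotvZl, dotvZr) (dotvC v u) => H.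
have : 0 <= dotv u u * (dotv u u * dotv v v - dotv u v ^+ 2) by nra.
rewrite pmulr_rge0 // subr_ge0 => {}H.
rewrite -(@ler_pXn2r _ 2) ?nnegrE ?mulr_ge0 ?sqrtr_ge0 //.
by rewrite exprMn !sqr_norm2 real_normK ?num_real.
Qed.

Lemma dotv_continuous w : continuous (dotv w).
Proof.
have -> : dotv w = fun y => \sum_i w i 0 * y i 0.
  by apply/funext => y; rewrite dotvE.
apply: continuous_big => [|i _ y]; first exact: add_continuous.
exact: (cvgM (cvg_cst _) (@coord_continuous R n 1 i 0 y)).
Qed.

Lemma dotvB_continuous w x : continuous (fun y : 'cV[R]_n => dotv w (y - x)).
Proof.
have -> : (fun y => dotv w (y - x)) = fun y => dotv w y - dotv w x.
  by apply/funext => y; rewrite dotvDr dotvNr.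
by move=> y; exact: (cvgD (dotv_continuous w y) (cvg_cst _)).
Qed.

End DotProduct.

(** * Exponential ridge functions, the extremal smooth terms *)

Section ExponentialFunction.
Context {R : realType} {n : nat}.
Implicit Types (u v w x y : 'cV[R]_n) (c : R).

(** The family is closed under directional derivatives, which only rescale [c]; smoothness of every
    order then follows by induction. The centre [x] is the point where the value is [c]. *)
Definition exp_ridge c w x y : R := c * expR (dotv w (y - x)).

Lemma exp_ridge_line c w x y u (s : R) :
  exp_ridge c w x (y + s *: u) = exp_ridge c w x y * expR (dotv w u * s).
Proof.
by rewrite /exp_ridge addrAC (dotvDr w (y - x)) dotvZr expRD mulrA [s * _]mulrC.
Qed.

Lemma exp_ridge_center c w x : exp_ridge c w x x = c.
Proof. by rewrite /exp_ridge subrr /dotv mulmx0 mxE expR0 mulr1. Qed.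

Lemma is_derive_cexpRM (K m t : R) :
  is_derive t 1 (fun s => K * expR (m * s)) (K * m * expR (m * t)).
Proof.
apply: (is_derive_eq (is_deriveM (is_derive_cst K t (1 : R)) (is_derive_expRM m t))).
by rewrite scaler0 addr0 -mulrA.
Qed.

Lemma derive1_cexpRM (K m : R) :
  (fun s => K * expR (m * s))^`()%classic = fun s => K * m * expR (m * s).
Proof.
apply/funext => t; rewrite derive1E.
exact: (@derive_val _ _ _ _ _ _ _ (is_derive_cexpRM K m t)).
Qed.

Lemma is_derive_exp_ridge c w x y u :
  is_derive y u (exp_ridge c w x) (exp_ridge (c * dotv w u) w x y).
Proof.
have E : (fun s : R => exp_ridge c w x (y + s *: u)) =
         (fun s => exp_ridge c w x y * expR (dotv w u * s)).
  by apply/funext => s; rewrite exp_ridge_line.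
have := is_derive_cexpRM (exp_ridge c w x y) (dotv w u) 0.
rewrite -E mulr0 expR0 mulr1 => H.
have := (is_derive_line (exp_ridge c w x) y u 0 _).2 H.
by rewrite scale0r addr0 /exp_ridge mulrAC.
Qed.

Lemma derive_exp_ridge c w x u y :
  'D_u (exp_ridge c w x) y = exp_ridge (c * dotv w u) w x y.
Proof. exact: (@derive_val _ _ _ _ _ _ _ (is_derive_exp_ridge c w x y u)). Qed.

Lemma derive_exp_ridgeE c w x u :
  'D_u (exp_ridge c w x) = exp_ridge (c * dotv w u) w x.
Proof. by apply/funext => y; exact: derive_exp_ridge. Qed.

Lemma dotv_basis w i : dotv w (basisv i) = w i 0.
Proof.
rewrite dotvE (bigD1 i) //= big1 ?addr0; first by rewrite mxE !eqxx mulr1.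
by move=> j ji; rewrite mxE (negbTE ji) mulr0.
Qed.

Lemma class_C_exp_ridge m c w x : class_C m (exp_ridge c w x).
Proof.
have C c' : continuous (exp_ridge c' w x).
  have K : continuous (fun z : 'cV[R]_n => expR (dotv w (z - x))).
    move=> y; apply: (@continuous_comp _ _ _ (fun z : 'cV[R]_n => dotv w (z - x)) expR).
      exact: dotvB_continuous.
    exact: continuous_expR.
  by move=> y; exact: (cvgM (cvg_cst c') (K y)).
elim: m c => [//|m IH] c; split=> // i; split=> [y|].
  by have [] := is_derive_exp_ridge c w x y (basisv i).
by rewrite derive_exp_ridgeE.
Qed.

Lemma gradient_exp_ridge c w x : gradient (exp_ridge c w x) x = c *: w.
Proof.
by apply/colP => i; rewrite !mxE derive_exp_ridge exp_ridge_center dotv_basis.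
Qed.

Lemma hessian_exp_ridge c w x u :
  dotv (hessian (exp_ridge c w x) x *m u) u = c * dotv w u ^+ 2.
Proof.
have H : hessian (exp_ridge c w x) x = c *: (w *m w^T).
  apply/matrixP => i j; rewrite !mxE derive_exp_ridgeE derive_exp_ridge exp_ridge_center.
  by rewrite !dotv_basis big_ord1 mxE mulrAC mulrA.
rewrite H -scalemxAl dotvZl -mulmxA [w^T *m u]mx11_scalar mul_mx_scalar dotvZl.
by rewrite -/(dotv w u).
Qed.

(** On a line, [phi t = K exp (m t)] with [m = <w,u>], so [phi''' = m phi''], and Cauchy-Schwarz
    gives [|m| <= M |u|]. Convexity is that of the exponential composed with an affine map. *)
Lemma self_concordant_like_exp_ridge c w x (M : R) :
  0 < M -> 0 <= c -> norm2 w <= M -> self_concordant_like M (exp_ridge c w x).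
Proof.
move=> M0 c0 wM; split=> //; first exact: class_C_exp_ridge.
  move=> t y z _ _; rewrite [X in _ <= X]convRE.
  have := ler_wpM2l c0 (convex_expR t (dotv w (y - x)) (dotv w (z - x))).
  rewrite !convRE mulrDr !(mulrCA c) /exp_ridge; apply: le_trans.
  rewrite ler_wpM2l // ler_expR -!dotvZr -dotvDr le_eqVlt; apply/orP; left.
  apply/eqP; congr dotv.
  rewrite !scalerBr addrACA -opprD -scalerDl /unstable.onem.
  by rewrite subrKC scale1r.
move=> y u t; cbv zeta.
have -> : (fun s : R => exp_ridge c w x (y + s *: u)) =
    (fun s => exp_ridge c w x y * expR (dotv w u * s)).
  by apply/funext => s; rewrite exp_ridge_line.
rewrite /derive1n /= !derive1_cexpRM.
set K := exp_ridge c w x y; set m := dotv w u.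
have K0 : 0 <= K by rewrite mulr_ge0 ?expR_ge0.
have -> : K * m * m * m * expR (m * t) = m * (K * m ^+ 2 * expR (m * t)) by ring.
have -> : K * m * m = K * m ^+ 2 by ring.
have S0 : 0 <= K * m ^+ 2 * expR (m * t).
  by rewrite mulr_ge0 ?expR_ge0 // mulr_ge0 ?sqr_ge0.
rewrite normrM (ger0_norm S0) [X in _ <= X]mulrAC ler_wpM2r //.
apply: le_trans (dotv_le_norm2 w u) _.
by rewrite ler_wpM2r ?sqrtr_ge0.
Qed.

End ExponentialFunction.

(** * Decrease of the composite objective and the matching lower bound *)

Section Step.
Context {R : realType} {n : nat}.
Implicit Types (f : 'cV[R]_n -> R) (g : 'cV[R]_n -> \bar R).
Implicit Types (x d y : 'cV[R]_n) (D : 'M[R]_n).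

Lemma le0_of_le_small (c B : R) :
  (forall t, 0 < t <= 1 -> c <= t * B) -> c <= 0.
Proof.
move=> H; rewrite leNgt; apply/negP => c0.
have N0 : 0 <= `|B| := normr_ge0 B.
have s0 : 0 < c + `|B| by lra.
(* If [c > 0], this [t] lies in []0, 1]] and turns the hypothesis into [c + |B| <= B], which is
   absurd. *)
have := H (c / (c + `|B|)).
rewrite divr_gt0 // ler_pdivrMr // mul1r lerDl N0 => /(_ isT).
rewrite mulrAC ler_pdivlMr // ler_pM2l // => K.
by have := ler_norm B; lra.
Qed.

(* First-order optimality of the prox step, obtained by comparing [x + d] with
   the points [t x + (1 - t) (x + d)] and letting [t] tend to [0]. *)
Lemma prox_decrease f g D x d :
  eproper g -> econvex g -> is_argmin (prox_model f g D x) (x + d) ->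
  (g x < +oo)%E ->
  exists gx gs : R, [/\ g x = gx%:E, g (x + d) = gs%:E &
    gs + dotv (gradient f x) d + dotv (D *m d) d <= gx].
Proof.
move=> [gN [y0 gy0]] cg am gxoo.
have gxE : g x = (fine (g x))%:E.
  by rewrite fineK // fin_numE gN /= lt_eqF.
(* An infinite value at [x + d] would make the model infinite there, against minimality compared
   with [y0]. *)
have gsE : g (x + d) = (fine (g (x + d)))%:E.
  rewrite fineK // fin_numE gN /=; apply/negP => /eqP gs.
  have := am y0; rewrite /prox_model gs addey // leye_eq => /eqP.
  by case: (g y0) gy0.
exists (fine (g x)), (fine (g (x + d))); split=> //.
move: gxE gsE; set gx := fine (g x); set gs := fine (g (x + d)) => gxE gsE.
set G := dotv _ d; set B := dotv _ d.
rewrite -subr_le0; apply: (le0_of_le_small _ (B / 2)) => t /andP[t0 t1].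
have yE : t *: x + (1 - t) *: (x + d) = x + (1 - t) *: d.
  by rewrite scalerDr addrA -scalerDl subrKC scale1r.
have gy : (g (x + (1 - t) *: d)%R <= (t * gx + (1 - t) * gs)%:E)%E.
  have := cg x (x + d) t; rewrite t1 ltW // => /(_ isT).
  by rewrite yE gxE gsE.
have xB e : x + e - x = e by rewrite addrC addKr.
have := am (x + (1 - t) *: d); rewrite /prox_model !xB gsE => H.
have {}H := le_trans H (leeD2l _ gy).
move: H; rewrite -!EFinD lee_fin -scalemxAr !dotvZr !dotvZl -/G -/B => H.
(* Here [H] amounts to [t (gs + G + B - gx) <= t^2 B / 2], and [t] is cancelled. *)
by rewrite -(ler_pM2l t0); nra.
Qed.

(* The bound [U], with [b] for beta^2 and [l] for lambda^2. *)
Definition step_bound (b r l a : R) : R :=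
  - a * b + l / r ^+ 2 * (expR (r * a) - 1 - r * a).

(** The linear term [a <grad f x, d>] of the bound on [f] cancels against the prox inequality
    multiplied by [a]. The range [0 <= a <= 1] lets convexity bound [g] at [x + a d] by its values
    at [x] and [x + d]. Finiteness at [x] is recorded so that the difference can be rearranged in
    the extended reals. *)
Lemma composite_decrease (M r a : R) f g D x d :
  self_concordant_like M f -> eproper g -> econvex g ->
  is_argmin (prox_model f g D x) (x + d) -> (objective f g x < +oo)%E ->
  r = M * norm2 d -> 0 < r -> 0 <= a <= 1 ->
  (objective f g (x + a *: d) - objective f g x <=
     (step_bound (dotv (D *m d) d) r (dotv (hessian f x *m d) d) a)%:E)%E /\
  exists Fx : R, objective f g x = Fx%:E.
Proof.
move=> scl pg cg am Fx rE r0 /andP[a0 a1].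
have gx : (g x < +oo)%E.
  rewrite ltey; apply/negP => /eqP E.
  by move: Fx; rewrite /objective E addey // ltxx.
have [gx' [gs [gxE gsE dec]]] := prox_decrease _ _ _ _ _ pg cg am gx.
split; last by exists (f x + gx'); rewrite /objective gxE.
have := self_concordant_like_upper_bound _ _ x d r a scl rE r0 a0.
set G := dotv (gradient f x) d in dec *; set q := dotv (hessian _ _ *m _) _.
set b := dotv _ d in dec *; move=> U.
have gy : (g (x + a *: d)%R <= (a * gs + (1 - a) * gx')%:E)%E.
  have := cg (x + d) x a; rewrite a0 a1 => /(_ isT).
  have -> : a *: (x + d) + (1 - a) *: x = x + a *: d.
    by rewrite scalerDr addrAC -scalerDl subrKC scale1r.
  by rewrite gxE gsE.
have gyE : g (x + a *: d) = (fine (g (x + a *: d)))%:E.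
  rewrite fineK // fin_numE pg.1 /=; apply/negP => /eqP E.
  by move: gy; rewrite E.
move: gy; rewrite /objective gyE gxE lee_fin => gy.
rewrite -!EFinD lee_fin /step_bound.
have : a * (gs + G + b) <= a * gx' by rewrite ler_wpM2l.
by move: gy U; lra.
Qed.

(* The extremal problem: [f] is an exponential along [d], for which the
   self-concordance inequality is an equality on the line [x + a d], and [g] is
   linear, chosen so that the prox step from [x] is exactly [d]. *)
Lemma worst_case_ge (M lam a : R) x D d :
  0 < M -> is_diag_mx D -> (forall i, 0 < D i i) -> d != 0 -> 0 < lam ->
  ((step_bound (dotv (D *m d) d) (M * norm2 d) (lam ^+ 2) a)%:E
     <= worst_case M x D d lam a)%E.
Proof.
move=> M0 dD D0 d0 lam0; have nd0 := norm2_gt0 d d0.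
set r := M * norm2 d; have r0 : 0 < r by rewrite mulr_gt0.
(* The scaling of [w] gives both [<w,d> = r] and [|w| = M]; the constant [c] makes the second
   derivative along [d] at [x], namely [c r^2], equal to [lam^2]. *)
pose w := (r / norm2 d ^+ 2) *: d; pose c := lam ^+ 2 / r ^+ 2.
have c0 : 0 <= c by rewrite divr_ge0 ?sqr_ge0.
have wd : dotv w d = r.
  by rewrite dotvZl -sqr_norm2 divfK // sqrf_eq0 gt_eqF.
have nw : norm2 w <= M.
  rewrite /norm2 dotvZl dotvZr -sqr_norm2.
  have -> : r / norm2 d ^+ 2 * (r / norm2 d ^+ 2 * norm2 d ^+ 2) = M ^+ 2.
    by rewrite /r; field; rewrite gt_eqF.
  by rewrite sqrtr_sqr ger0_norm // ltW.
(* With [v = grad f x + D d] and [g] of slope [- v], the prox model is stationary at [x + d]. *)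
pose f := exp_ridge c w x; pose v := c *: w + D *m d.
pose g := fun y : 'cV[R]_n => (- dotv v (y - x))%:E.
have gxd s : g (x + s *: d) = (- (s * dotv v d))%:E.
  by rewrite /g addrC addKr dotvZr.
have gx : g x = 0%:E.
  by have := gxd 0; rewrite scale0r addr0 mul0r oppr0.
apply: ereal_sup_ubound; exists f, g; split.
- exact: self_concordant_like_exp_ridge.
- split; first by split=> [y //|]; exists x; rewrite gx ltry.
    move=> y b; rewrite /g lte_fin => by_.
    exists [set z | b < - dotv v (z - x)]; last by move=> z; rewrite /= lte_fin.
    have C : - dotv v (z - x) @[z --> y] --> - dotv v (y - x).
      exact: (cvgN (dotvB_continuous v x y)).
    exact: (cvgr_gt _ C _ by_).
  move=> y z t _; rewrite /g -!EFinM -EFinD lee_fin le_eqVlt; apply/orP; left.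
  apply/eqP; rewrite !dotvDr !dotvNr !dotvZr; ring.
- by rewrite /objective gx ltry.
- split.
    move=> y; rewrite /prox_model /g gradient_exp_ridge -!EFinD lee_fin.
    rewrite [x + d]addrC addrK.
    have [e ->] : exists e, y = e + x by exists (y - x); rewrite subrK.
    rewrite addrK.
    (* The model at [x + e] exceeds the model at [x + d] by exactly [<D (e - d), e - d> / 2]. *)
    have := dotv_diag_ge0 D (e - d) dD D0.
    rewrite mulmxDr mulmxN !(dotvDl, dotvDr, dotvNl, dotvNr) (dotv_diagC D d e dD).
    by rewrite /v ?dotvDl; lra.
  rewrite /wnorm hessian_exp_ridge wd /c divfK ?sqrf_eq0 ?gt_eqF //.
  by rewrite sqrtr_sqr ger0_norm // ltW.
rewrite /objective gxd gx /f exp_ridge_line exp_ridge_center wd adde0.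
rewrite -!EFinD; congr (_%:E).
rewrite /step_bound /v dotvDl dotvZl wd /c.
by field; rewrite gt_eqF.
Qed.

(** The hypothesis on [al] says that the derivative of [step_bound] vanishes there. The tangent
    inequality [1 + y <= exp y] at [y = r (a - al)] then makes [al] a minimiser over the whole
    line. *)
Lemma step_bound_min (b r l al a : R) : 0 < r -> 0 <= l ->
  l * expR (r * al) = l + b * r -> step_bound b r l al <= step_bound b r l a.
Proof.
move=> r0 l0 E.
have H : l * expR (r * al) * (1 + r * (a - al)) <= l * expR (r * a).
  have -> : expR (r * a) = expR (r * al) * expR (r * (a - al)).
    by rewrite -expRD; congr expR; ring.
  by rewrite mulrA ler_wpM2l ?mulr_ge0 ?expR_ge0 // expR_ge1Dx.
have F c : step_bound b r l c = (l * expR (r * c) - l - l * r * c - b * r ^+ 2 * c) / r ^+ 2.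
  by rewrite /step_bound; field; rewrite gt_eqF.
rewrite !F ler_pM2r ?invr_gt0 ?exprn_gt0 //.
by move: H; rewrite E; lra.
Qed.

(** [Num.sqrt] is 0 on negative numbers, so positivity of [wnorm A u] forces the quadratic form to
    be positive. *)
Lemma dotv_wnorm (A : 'M[R]_n) (u : 'cV[R]_n) : 0 < wnorm A u ->
  dotv (A *m u) u = wnorm A u ^+ 2.
Proof. by rewrite /wnorm sqrtr_gt0 => /ltW A0; rewrite sqr_sqrtr. Qed.

End Step.

(** * The logarithmic step-size: range, decrease and optimality *)

Theorem lemma2 (R : realType) (n : nat) (M : R)
    (f : 'cV[R]_n -> R) (g : 'cV[R]_n -> \bar R)
    (x s : nat -> 'cV[R]_n) (D : nat -> 'M[R]_n) (alpha : nat -> R) :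
  self_concordant_like M f ->
  eproper g -> lower_semicontinuous g -> econvex g ->
  let F := objective f g in
  let d := fun k => s k - x k in
  (F (x 0%N) < +oo)%E ->
  (forall k, is_diag_mx (D k) /\ (forall i, 0 < D k i i)) ->
  (forall k, is_argmin (prox_model f g (D k) (x k)) (s k)) ->
  (forall k, x k.+1 = x k + alpha k *: d k) ->
  forall k,
  let lambda := wnorm (hessian f (x k)) (d k) in
  let r := M * norm2 (d k) in
  let beta := wnorm (D k) (d k) in
  d k != 0 -> 0 < lambda ->
  alpha k = r^-1 * ln (1 + beta ^+ 2 * r / lambda ^+ 2) ->
  beta ^+ 2 * r <= (expR r - 1) * lambda ^+ 2 ->
  [/\ 0 < alpha k <= 1,
      (F (x k.+1) <= F (x k) -
        (beta ^+ 2 / r *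
          ((1 + lambda ^+ 2 / (r * beta ^+ 2))
             * ln (1 + beta ^+ 2 * r / lambda ^+ 2) - 1))%:E)%E &
      forall a : R,
        (worst_case M (x k) (D k) (d k) lambda (alpha k)
           <= worst_case M (x k) (D k) (d k) lambda a)%E].
Proof.
move=> scl pg _ cg F d F0 HD am xS k lambda r beta dk0 lam0 aE hyp.
have [dD D0] := HD k; have [M0 _ _ _] := scl.
have nd0 := norm2_gt0 _ dk0; have r0 : 0 < r by rewrite mulr_gt0.
have b0 := dotv_diag_gt0 _ _ dD D0 dk0.
have bE : dotv (D k *m d k) (d k) = beta ^+ 2.
  by rewrite dotv_wnorm // /wnorm sqrtr_gt0.
rewrite bE in b0.
have l0 : 0 < lambda ^+ 2 by rewrite exprn_gt0.
have sE : x k + d k = s k by rewrite /d addrC subrK.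
have K0 : 0 < beta ^+ 2 * r / lambda ^+ 2 by rewrite divr_gt0 // mulr_gt0.
have lnE : ln (1 + beta ^+ 2 * r / lambda ^+ 2) = r * alpha k.
  by rewrite aE mulVKf // gt_eqF.
(* This is the stationarity condition required by [step_bound_min]. *)
have expE : lambda ^+ 2 * expR (r * alpha k) = lambda ^+ 2 + beta ^+ 2 * r.
  by rewrite -lnE lnK ?posrE; [field; rewrite gt_eqF | lra].
have a0 : 0 < alpha k.
  by rewrite aE mulr_gt0 ?invr_gt0 // ln_gt0 // ltrDl.
(* Exponentiating and multiplying by [lambda^2] turns this into the hypothesis [hyp]. *)
have a1 : alpha k <= 1.
  rewrite -(ler_pM2l r0) mulr1 -ler_expR -(ler_pM2l l0) expE.
  by move: hyp; lra.
have UE : step_bound (beta ^+ 2) r (lambda ^+ 2) (alpha k) =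
    - (beta ^+ 2 / r * ((1 + lambda ^+ 2 / (r * beta ^+ 2))
         * ln (1 + beta ^+ 2 * r / lambda ^+ 2) - 1)).
  rewrite lnE /step_bound !mulrBr !mulr1.
  have -> : lambda ^+ 2 / r ^+ 2 * expR (r * alpha k) =
      (lambda ^+ 2 + beta ^+ 2 * r) / r ^+ 2 by rewrite -expE mulrAC.
  have bn0 : beta != 0 by rewrite -sqrf_eq0 gt_eqF.
  by field; rewrite bn0 gt_eqF.
have a01 : 0 <= alpha k <= 1 by rewrite ltW.
rewrite a0 a1; split=> // [|a].
  (* If [F (x k)] is infinite, the right-hand side is [+oo] and the inequality is trivial. *)
  have [Foo|] := ltP (F (x k)) +oo%E; last first.
    by rewrite leye_eq => /eqP ->; rewrite leey.
  have am' : is_argmin (prox_model f g (D k) (x k)) (x k + d k) by rewrite sE.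
  have [] := composite_decrease M r (alpha k) f g (D k) (x k) (d k)
    scl pg cg am' Foo erefl r0 a01.
  rewrite bE dotv_wnorm // -/lambda UE => H [Fx FxE]; move: H.
  by rewrite -xS /F FxE leeBlDr // addeC -EFinN.
have step := step_bound_min _ _ _ _ a r0 (ltW l0) expE.
(* Chain: worst case of [alpha k] <= [U (alpha k)] <= [U a] <= worst case of [a]. All competing
   problems share [d], [D] and [lambda], so one bound [U] serves them all. *)
apply: (@le_trans _ _ (step_bound (beta ^+ 2) r (lambda ^+ 2) (alpha k))%:E).
  apply: ge_ereal_sup => z [f' [g' [scl' [pg' _ cg'] Foo [am' lE] ->]]].
  have [] := composite_decrease M r (alpha k) f' g' (D k) (x k) (d k)
    scl' pg' cg' am' Foo erefl r0 a01.
  by rewrite bE dotv_wnorm ?lE // => ? _.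
apply: le_trans (worst_case_ge M lambda a (x k) (D k) (d k) M0 dD D0 dk0 lam0).
by rewrite bE lee_fin.
Qed.
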